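(* Consider an irreducible continuous-time Markov chain on the finite state space $S=\{1,\dots,m\}$ with infinitesimal generator $Q=[q_{ij}]$, where $0<-q_{ii}<\infty$ for all $i$. Let $\pi$ be the stationary probability vector of the embedded jump chain, $\lambda=\sum_{i=1}^m\pi_i/(-q_{ii})$, and $m_{ij}$ the mean first passage times. Let $k^{(1)}=(k^{(1)}_1,\dots,k_m^{(1)})^T$ with $k_i^{(1)}=\sum_{j=1}^m\pi_jm_{ij}$. If $u\in\mathbb{R}^m$ satisfies $u^Te\neq0$ and $H=[Q+eu^T]^{-1}$, then $$k^{(1)}=\lambda\left[I-HQ_d+\mathrm{tr}(HQ_d)I\right]e.$$
   Context: The generator satisfies $q_{ij}\ge0$ for $i\neq j$ and $\sum_jq_{ij}=0$. The embedded jump chain has transition matrix $P=[p_{ij}]$ with $p_{ii}=0$ and $p_{ij}=-q_{ij}/q_{ii}$ for $i\ne j$; irreducibility means that $P$ is irreducible. The sojourn time on each visit to state $i$ is exponential with rate $\nu_i=-q_{ii}$, hence with mean $\mu_i=1/\nu_i$. $\pi$ is the unique vector with $\pi^TP=\pi^T$ and $\pi^Te=1$, where $e=(1,\dots,1)^T$; thus $\lambda=\pi^T\mu$. $m_{ij}$ is the expected time, starting in state $i$, of the first jump into state $j$ (for $i=j$, the mean time of first return to $i$ after leaving it). $Q_d$ is the diagonal matrix with the same diagonal as $Q$. *)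

(* Defs.v *)
(* MathComp / MathComp-Analysis *)
From HB Require Import structures.
From mathcomp Require Import all_boot all_order all_algebra.
From mathcomp Require Import all_classical all_reals all_analysis.

Set Implicit Arguments.
Unset Strict Implicit.
Unset Printing Implicit Defensive.
Import Order.TTheory GRing.Theory Num.Theory.
Import numFieldNormedType.Exports.
Local Open Scope classical_set_scope.
Local Open Scope ring_scope.

Definition generator (R : realType) (m : nat) (Q : 'M[R]_m) : Prop :=
  (forall i j, i != j -> 0 <= Q i j) /\ (forall i, \sum_j Q i j = 0).

Definition jump_matrix (R : realType) (m : nat) (Q : 'M[R]_m) : 'M[R]_m :=
  \matrix_(i, j) (if i == j then 0 else - Q i j / Q i i).

Definition irreducible_mx (R : realType) (m : nat) (P : 'M[R]_m) : Prop :=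
  forall i j, exists n, 0 < (P ^+ n) i j.

Definition ones (R : realType) (m : nat) : 'cV[R]_m := const_mx 1.
Arguments ones {R m}.

Definition stationary_vector (R : realType) (m : nat) (P : 'M[R]_m)
    (pi : 'cV[R]_m) : Prop :=
  pi^T *m P = pi^T /\ pi^T *m ones = 1%:M.

Definition diag_part (R : realType) (m : nat) (Q : 'M[R]_m) : 'M[R]_m :=
  diag_mx (\row_i Q i i).

(* [Pr i] is the law of the chain started in state i, [Y n] the n-th state
   visited and [T n] the length of the n-th sojourn. The product formula says
   that, under [Pr i], Y is a Markov chain started at i with transition matrix
   [jump_matrix Q] and that, conditionally on Y, the sojourn times are
   independent, T n being exponential with rate - q_xx for x = Y n. As 'I_m has
   no canonical sigma-algebra, measurability of [Y n] is stated on points. *)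
Definition markov_jump_process (R : realType) (m : nat) (Q : 'M[R]_m)
    (d : measure_display) (Omega : measurableType d)
    (Pr : 'I_m -> probability Omega R)
    (Y : nat -> Omega -> 'I_m) (T : nat -> Omega -> R) : Prop :=
  [/\ forall n x, measurable (Y n @^-1` [set x]),
      forall n, measurable_fun [set: Omega] (T n)
    & forall (i : 'I_m) (n : nat) (x : nat -> 'I_m) (A : nat -> set R),
        (forall k, measurable (A k)) ->
        Pr i [set w | forall k, (k <= n)%N -> Y k w = x k /\ A k (T k w)] =
        (((x 0%N == i)%:R *
          \prod_(0 <= k < n) jump_matrix Q (x k) (x k.+1))%:E *
         \prod_(0 <= k < n.+1)
            exponential_prob (- Q (x k) (x k)) (A k))%E].

(* Time of the first jump into j. The n-th jump (n >= 1) takes place at time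
   T 0 + ... + T (n - 1) and leads to Y n, so the initial state does not count
   as a visit; the value is +oo if no jump ever leads to j. *)
Definition first_passage_time (R : realType) (m : nat) (Omega : Type)
    (Y : nat -> Omega -> 'I_m) (T : nat -> Omega -> R)
    (j : 'I_m) (w : Omega) : \bar R :=
  match pselect (exists n, (0 < n)%N && (Y n w == j)) with
  | left hits => (\sum_(0 <= k < ex_minn hits) T k w)%:E
  | right _ => +oo%E
  end.

Definition mean_first_passage_time (R : realType) (m : nat)
    (d : measure_display) (Omega : measurableType d)
    (Pr : 'I_m -> probability Omega R)
    (Y : nat -> Omega -> 'I_m) (T : nat -> Omega -> R) (i j : 'I_m) : \bar R :=
  (\int[Pr i]_w first_passage_time Y T j w)%E.

Definition k1 (R : realType) (m : nat)
    (d : measure_display) (Omega : measurableType d)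
    (Pr : 'I_m -> probability Omega R)
    (Y : nat -> Omega -> 'I_m) (T : nat -> Omega -> R)
    (pi : 'cV[R]_m) : 'cV[\bar R]_m :=
  \col_i (\sum_j (pi j ord0)%:E * mean_first_passage_time Pr Y T i j)%E.

(* Main.v *)
Require Import Defs.
From HB Require Import structures.
From mathcomp Require Import all_boot all_order all_algebra.
From mathcomp Require Import all_classical all_reals all_analysis.
From mathcomp Require Import measurable_realfun ring.

Set Implicit Arguments.
Unset Strict Implicit.
Unset Printing Implicit Defensive.
Import Order.TTheory GRing.Theory Num.Theory.
Import numFieldNormedType.Exports.
Local Open Scope classical_set_scope.
Local Open Scope ring_scope.

(** Let B_j be the jump matrix P with column j set to zero, so that B_j ^+ k
    governs the first k jumps while none of them leads to j. Summing the
    sojourns made before the first jump into j gives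
    m_ij = \sum_k (B_j ^+ k mu)_i, and by a maximum principle (irreducibility)
    this is finite and the solution of x = mu + B_j x. In matrix form, with M_d
    the diagonal part of M, M = mu e^T + P (M - M_d). Multiplying by pi^T gives
    pi_j m_jj = lambda; multiplying by Q_d, where Q = Q_d (I - P), and then
    by H gives M = e c^T + (I - H Q_d) M_d for some vector c. The diagonal
    entries force c_j = (H Q_d)_jj m_jj, and k^(1) = M pi follows. *)

(** * Nonnegative matrices, taboo matrices and the maximum principle *)

Definition taboo (R : realType) (m : nat) (P : 'M[R]_m) (j : 'I_m) : 'M[R]_m :=
  \matrix_(a, b) (if b == j then 0 else P a b).

Lemma unitmx_injective (F : fieldType) (n : nat) (A : 'M[F]_n) :
  (forall v : 'cV_n, A *m v = 0 -> v = 0) -> A \in unitmx.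
Proof.
move=> inj; rewrite -unitmx_tr -row_free_unit -kermx_eq0.
apply/rowV0P => v /sub_kermxP vA; apply: trmx_inj; rewrite trmx0.
by apply: inj; rewrite -[A]trmxK -trmx_mul vA trmx0.
Qed.

Lemma mulmx_ge0 (R : numDomainType) (p q r : nat) (A : 'M[R]_(p, q))
    (B : 'M[R]_(q, r)) :
  (forall a b, 0 <= A a b) -> (forall a b, 0 <= B a b) ->
  forall a b, 0 <= (A *m B) a b.
Proof. by move=> A0 B0 a b; rewrite mxE sumr_ge0// => c _; rewrite mulr_ge0. Qed.

Lemma expmx_ge0 (R : numDomainType) (m : nat) (A : 'M[R]_m) (n : nat) :
  (forall a b, 0 <= A a b) -> forall a b, 0 <= (A ^+ n) a b.
Proof.
move=> A0; elim: n => [|n IH] a b; first by rewrite expr0 mxE ler0n.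
by rewrite exprSr -mulmxE mulmx_ge0.
Qed.

Lemma taboo_ge0 (R : realType) (m : nat) (P : 'M[R]_m) (j : 'I_m) :
  (forall a b, 0 <= P a b) -> forall a b, 0 <= taboo P j a b.
Proof. by move=> P0 a b; rewrite mxE; case: ifP. Qed.

(** Last step of a path of positive weight: a nonzero sum of nonnegative terms has a positive
    term. *)
Lemma expmx_step (R : realDomainType) (m : nat) (A : 'M[R]_m) (n : nat)
    (a c : 'I_m) :
  (forall a b, 0 <= A a b) -> 0 < (A ^+ n.+1) a c ->
  exists2 b, 0 < (A ^+ n) a b & 0 < A b c.
Proof.
move=> A0; rewrite exprSr -mulmxE mxE => /lt0r_neq0.
rewrite psumr_neq0 => [|b _]; last by rewrite mulr_ge0 ?expmx_ge0.
case/hasP => b _; rewrite andTb; have := expmx_ge0 n A0 a b.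
rewrite le_eqVlt => /predU1P[<-|Ab]; first by rewrite mul0r ltxx.
by rewrite pmulr_rgt0//; exists b.
Qed.

(** The exponent 0 could witness irreducibility from [j] to [j]. The path therefore starts at a
    successor [c] of [j], distinct from [j] because the diagonal vanishes, and its last step enters
    [j]. *)
Lemma irreducible_col (R : realType) (m : nat) (P : 'M[R]_m) (j : 'I_m) :
  (forall a b, 0 <= P a b) -> (forall a, P a a = 0) ->
  (forall a, \sum_b P a b = 1) -> irreducible_mx P -> exists b, 0 < P b j.
Proof.
move=> P0 Pd P1 irr.
have : \sum_b P j b != 0 by rewrite P1 oner_eq0.
rewrite psumr_neq0// => /hasP[c _ /= jc].
have [[|n]] := irr c j.
  rewrite expr0 mxE; case: eqP => [cj|_]; last by rewrite ltxx.
  by move: jc; rewrite cj Pd ltxx.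
by move=> /(expmx_step P0)[b _ bj]; exists b.
Qed.

(* Maximum principle: the set where v attains a positive maximum is closed
   under P and avoids the predecessors of j. *)
Lemma taboo_subharmonic_le0 (R : realType) (m : nat) (P : 'M[R]_m) (j : 'I_m)
    (v : 'cV[R]_m) :
  (forall a b, 0 <= P a b) -> (forall a, P a a = 0) ->
  (forall a, \sum_b P a b = 1) -> irreducible_mx P ->
  (forall a, v a 0 <= (taboo P j *m v) a 0) -> forall a, v a 0 <= 0.
Proof.
move=> P0 Pd P1 irr vle a0; rewrite leNgt; apply/negP => va0.
pose a := [arg max_(i > a0) v i 0]%O.
have amax b : v b 0 <= v a 0 by rewrite /a; case: arg_maxP => // i _ imax; exact: imax.
have va : 0 < v a 0 by exact: lt_le_trans va0 (amax a0).
have step b c : v b 0 = v a 0 -> 0 < P b c -> c != j /\ v c 0 = v a 0.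
  move=> vb Pbc.
  (* The terms are nonnegative and sum to [v b] minus entry [b] of [taboo P j *m v], which is at
     most 0, so each vanishes. For [c = j] the term would be [P b j * v a > 0]. *)
  have term_ge0 k : 0 <= P b k * v a 0 - taboo P j b k * v k 0.
    rewrite subr_ge0 mxE; case: ifP => _; first by rewrite mul0r mulr_ge0// ltW.
    by rewrite ler_wpM2l.
  have : \sum_k (P b k * v a 0 - taboo P j b k * v k 0) <= 0.
    by rewrite sumrB -mulr_suml P1 mul1r subr_le0 -vb (le_trans (vle b))// mxE.
  move=> sum_le0; have : P b c * v a 0 - taboo P j b c * v c 0 == 0.
    have s0 : \sum_k (P b k * v a 0 - taboo P j b k * v k 0) = 0.
      by apply/le_anti; rewrite sum_le0 sumr_ge0.
    by apply/eqP; apply: (psumr_eq0P _ s0).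
  rewrite subr_eq0 mxE; case: ifP => [_|/negbT cj].
    by rewrite mul0r mulf_eq0 !gt_eqF.
  by rewrite (inj_eq (mulfI (lt0r_neq0 Pbc))) => /eqP ->.
have reach n c : 0 < (P ^+ n) a c -> v c 0 = v a 0.
  elim: n c => [|n IH] c.
    by rewrite expr0 mxE; case: eqP => [->//|_]; rewrite ltxx.
  by move=> /(expmx_step P0)[b /IH vb /(step _ _ vb)[]].
have [b Pbj] := irreducible_col j P0 Pd P1 irr.
have [n /reach vb] := irr a b.
by have [] := step _ _ vb Pbj; rewrite eqxx.
Qed.

Lemma taboo_harmonic_eq0 (R : realType) (m : nat) (P : 'M[R]_m) (j : 'I_m)
    (v : 'cV[R]_m) :
  (forall a b, 0 <= P a b) -> (forall a, P a a = 0) ->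
  (forall a, \sum_b P a b = 1) -> irreducible_mx P ->
  taboo P j *m v = v -> v = 0.
Proof.
move=> P0 Pd P1 irr Pv; apply/colP => a; rewrite [RHS]mxE.
have le0 (w : 'cV[R]_m) : taboo P j *m w = w -> forall a, w a 0 <= 0.
  move=> Pw; apply: (@taboo_subharmonic_le0 _ _ P j) => // b.
  by rewrite Pw.
apply/le_anti; rewrite le0//= -oppr_le0.
by have := le0 (- v) _ a; rewrite mxE; apply; rewrite mulmxN Pv.
Qed.

(** Once the constant [v j 0] is subtracted, entry [j] vanishes, so that zeroing column [j] of [P]
    changes nothing and the difference is taboo-harmonic. *)
Lemma harmonic_const (R : realType) (m : nat) (P : 'M[R]_m) (j : 'I_m)
    (v : 'cV[R]_m) :
  (forall a b, 0 <= P a b) -> (forall a, P a a = 0) ->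
  (forall a, \sum_b P a b = 1) -> irreducible_mx P ->
  P *m v = v -> v = v j 0 *: ones.
Proof.
move=> P0 Pd P1 irr Pv; apply/eqP; rewrite -subr_eq0; apply/eqP.
apply: (taboo_harmonic_eq0 P0 Pd P1 irr (j := j)).
apply/colP => a; have /colP/(_ a) := Pv; rewrite !mxE => <-.
have -> : v j 0 * 1 = \sum_b P a b * v j 0 by rewrite -mulr_suml P1 mul1r mulr1.
rewrite -sumrB; apply: eq_bigr => b _; rewrite !mxE mulr1.
by case: eqP => [->|_]; rewrite ?mul0r ?subrr// mulrBr.
Qed.

(** [1%:M - taboo P j] is injective because taboo-harmonic vectors vanish. As [c] is nonnegative,
    [- x] is taboo-subharmonic, hence nonpositive. *)
Lemma passage_system_solvable (R : realType) (m : nat) (P : 'M[R]_m) (j : 'I_m)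
    (c : 'cV[R]_m) :
  (forall a b, 0 <= P a b) -> (forall a, P a a = 0) ->
  (forall a, \sum_b P a b = 1) -> irreducible_mx P ->
  (forall a, 0 <= c a 0) ->
  exists2 x : 'cV[R]_m, x = c + taboo P j *m x & forall a, 0 <= x a 0.
Proof.
move=> P0 Pd P1 irr c0.
have U : 1%:M - taboo P j \in unitmx.
  apply: unitmx_injective => v; rewrite mulmxBl mul1mx => /eqP.
  by rewrite subr_eq0 => /eqP/esym; exact: taboo_harmonic_eq0.
pose x := invmx (1%:M - taboo P j) *m c.
have xE : x = c + taboo P j *m x.
  apply/eqP; rewrite -subr_eq -{1}[x]mul1mx -mulmxBl.
  by rewrite mulmxA mulmxV// mul1mx.
exists x => // a; rewrite -oppr_le0.
have := @taboo_subharmonic_le0 _ _ P j (- x) P0 Pd P1 irr _ a.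
rewrite mxE; apply => b; rewrite mulmxN [leLHS]mxE [leRHS]mxE lerN2.
by move/colP/(_ b): xE; rewrite [RHS]mxE => ->; rewrite lerDr.
Qed.

Lemma passage_partial_sum (R : realType) (m : nat) (B : 'M[R]_m)
    (c x : 'cV[R]_m) (n : nat) : x = c + B *m x ->
  x = \sum_(0 <= k < n) B ^+ k *m c + B ^+ n *m x.
Proof.
move=> xE; elim: n => [|n {1}->]; first by rewrite big_nil expr0 add0r mul1mx.
by rewrite big_nat_recr//= exprSr -mulmxE -mulmxA -addrA -mulmxDr -xE.
Qed.

(** The partial sums of [B ^+ k *m c] increase and stay below [x], so their terms tend to 0; a
    multiple of [c] dominates [v]. *)
Lemma taboo_power_cvg0 (R : realType) (m : nat) (B : 'M[R]_m)
    (c x v : 'cV[R]_m) (i : 'I_m) :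
  (forall a b, 0 <= B a b) -> (forall a, 0 < c a 0) ->
  (forall a, 0 <= x a 0) -> (forall a, 0 <= v a 0) -> x = c + B *m x ->
  (B ^+ n *m v) i 0 @[n --> \oo] --> (0 : R).
Proof.
move=> B0 c0 x0 v0 xE.
have Bk0 (w : 'cV[R]_m) n a : (forall a, 0 <= w a 0) -> 0 <= (B ^+ n *m w) a 0.
  by move=> w0; apply: mulmx_ge0 => [|a' b']; [exact: expmx_ge0|rewrite ord1].
have cvgc a : (B ^+ n *m c) a 0 @[n --> \oo] --> (0 : R).
  apply: cvg_series_cvg_0; apply: nondecreasing_is_cvgn.
    apply/nondecreasing_seqP => n; rewrite /series/= big_nat_recr//= lerDl.
    by apply: Bk0 => b; exact: ltW.
  exists (x a 0) => _ [n _ <-].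
  have /colP/(_ a) := passage_partial_sum n xE; rewrite [RHS]mxE summxE => ->.
  by rewrite /series/= lerDl Bk0.
(* A sum of nonnegative ratios bounds each of them, whence [v <= K c] entrywise. *)
pose K := \sum_b v b 0 / c b 0.
apply: (@squeeze_cvgr _ _ _ _ (cst 0) (fun n => K * (B ^+ n *m c) i 0)).
- near=> n; rewrite Bk0//=.
  rewrite [leLHS]mxE [in leRHS]mxE mulr_sumr ler_sum// => b _.
  rewrite mulrCA ler_wpM2l ?expmx_ge0//.
  rewrite -ler_pdivrMr// /K (bigD1 b)//= lerDl sumr_ge0// => k _.
  by rewrite divr_ge0// ltW.
- exact: cvg_cst.
- by rewrite -[X in _ --> X](mulr0 K); apply: cvgMr; exact: cvgc.
Unshelve. all: by end_near. Qed.

(** * The jump matrix and the invertibility of the perturbed generator *)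

Lemma jump_matrix_ge0 (R : realType) (m : nat) (Q : 'M[R]_m) :
  generator Q -> (forall i, 0 < - Q i i) -> forall a b, 0 <= jump_matrix Q a b.
Proof.
move=> [Q0 _] Qd a b; rewrite mxE; case: eqVneq => // ab.
by rewrite mulNr -mulrN -invrN divr_ge0 ?Q0// ltW.
Qed.

Lemma jump_matrix_sum (R : realType) (m : nat) (Q : 'M[R]_m) :
  generator Q -> (forall i, 0 < - Q i i) ->
  forall a, \sum_b jump_matrix Q a b = 1.
Proof.
move=> [_ Qs] Qd a; have := Qs a.
have Qa : Q a a != 0 by rewrite -oppr_eq0 gt_eqF.
rewrite (bigD1 a)//= => /eqP; rewrite addr_eq0 => /eqP Qaa.
rewrite (bigD1 a)//= mxE eqxx add0r.
under eq_bigr => b ba do rewrite mxE eq_sym (negPf ba).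
by rewrite -mulr_suml sumrN -Qaa divff.
Qed.

Lemma generator_factor (R : realType) (m : nat) (Q : 'M[R]_m) :
  (forall i, 0 < - Q i i) ->
  Q = diag_part Q *m (1%:M - jump_matrix Q).
Proof.
move=> Qd; apply/matrixP => a b; rewrite mul_diag_mx !mxE.
have Qa : Q a a != 0 by rewrite -oppr_eq0 gt_eqF.
case: eqP => [<-|_]; first by rewrite subr0 mulr1.
by rewrite sub0r mulNr opprK mulrCA divff// mulr1.
Qed.

(** If [v] is in the kernel, multiplying by [x^T] leaves [(x^T e)(u^T v) = 0]. Thus [u^T v = 0] and
    [Q v = 0], so [v] is constant, and [u^T e != 0] makes the constant zero. *)
Lemma generator_rank1_unitmx (R : realType) (m : nat) (Q : 'M[R]_m)
    (u x : 'cV[R]_m) (j : 'I_m) :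
  generator Q -> (forall i, 0 < - Q i i) -> irreducible_mx (jump_matrix Q) ->
  x^T *m Q = 0 -> x^T *m ones != 0 -> u^T *m ones != 0 ->
  Q + ones *m u^T \in unitmx.
Proof.
move=> gQ Qd irr xQ xe ue; apply: unitmx_injective => v Av.
have uv : u^T *m v = 0.
  have := congr1 (mulmx x^T) Av; rewrite mulmx0 mulmxDl mulmxDr !mulmxA xQ.
  rewrite mul0mx add0r -mulmxA => /eqP.
  rewrite [x^T *m _]mx11_scalar mul_scalar_mx scaler_eq0 => /orP[|/eqP//].
  by move=> /eqP e; move: xe; rewrite [x^T *m _]mx11_scalar e raddf0 eqxx.
have Qv : Q *m v = 0 by move: Av; rewrite mulmxDl -mulmxA uv mulmx0 addr0.
have Pv : jump_matrix Q *m v = v.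
  apply/colP => a; have /colP/(_ a) := Qv.
  rewrite {1}(generator_factor Qd) -mulmxA mul_diag_mx [LHS]mxE [in RHS]mxE.
  have Qa : Q a a != 0 by rewrite -oppr_eq0 gt_eqF.
  move/eqP; rewrite mxE mulf_eq0 (negPf Qa)/= mulmxBl mul1mx !mxE subr_eq0.
  by move=> /eqP.
have vE := harmonic_const j (jump_matrix_ge0 gQ Qd) _ (jump_matrix_sum gQ Qd) irr Pv.
have {}vE : v = v j 0 *: ones by apply: vE => a; rewrite mxE eqxx.
move: uv; rewrite vE -scalemxAr => /eqP; rewrite scaler_eq0 (negPf ue) orbF.
by move=> /eqP ->; rewrite scale0r.
Qed.

(** * Matrix algebra of the passage equations *)

(** Zeroing column [j] of [P] has the same effect on column [j] of [M] as zeroing the diagonal entry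
    [M j j], which puts all [j] into one equation. *)
Lemma passage_column_equation (R : realType) (m : nat) (P M : 'M[R]_m)
    (mu : 'cV[R]_m) :
  (forall j, col j M = mu + taboo P j *m col j M) ->
  M = mu *m ones^T + P *m (M - diag_part M).
Proof.
move=> ME; apply/matrixP => i j.
have /colP/(_ i) := ME j; rewrite [LHS]mxE => ->; rewrite !mxE; congr (_ + _).
  by rewrite big_ord1 !mxE mulr1.
apply: eq_bigr => b _; rewrite !mxE; case: eqP => [->|_].
  by rewrite mulr1n subrr mulr0 mul0r.
by rewrite mulr0n subr0.
Qed.

(** After multiplication by [pi^T] both sides contain [pi^T *m M]; cancelling it leaves
    [pi^T M_d = (pi^T mu) e^T]. *)
Lemma stationary_diag (R : realType) (m : nat) (P M : 'M[R]_m)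
    (mu pi : 'cV[R]_m) :
  stationary_vector P pi -> M = mu *m ones^T + P *m (M - diag_part M) ->
  forall j, pi j 0 * M j j = \sum_i pi i 0 * mu i 0.
Proof.
move=> [piP _] ME j; have := congr1 (mulmx pi^T) ME.
rewrite mulmxDr (mulmxA _ P) piP mulmxBr addrCA -[X in X = _]addr0.
move=> /addrI/esym/eqP; rewrite subr_eq0 => /eqP/rowP/(_ j).
rewrite mulmxA mul_mx_diag !mxE.
rewrite big_ord1 !mxE mulr1 => <-.
by apply: eq_bigr => i _; rewrite mxE.
Qed.

Lemma passage_matrix_formula (R : realType) (m : nat) (Q M H : 'M[R]_m)
    (pi u : 'cV[R]_m) :
  let lambda := \sum_i pi i 0 / (- Q i i) in
  generator Q -> (forall i, 0 < - Q i i) ->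
  u^T *m ones != 0 -> H *m (Q + ones *m u^T) = 1%:M ->
  M = (\col_i (- Q i i)^-1) *m ones^T + jump_matrix Q *m (M - diag_part M) ->
  (forall j, pi j 0 * M j j = lambda) ->
  M *m pi = lambda *:
    ((1%:M - H *m diag_part Q + (\tr (H *m diag_part Q))%:M) *m ones).
Proof.
move=> lambda [_ Qs] Qd ue HA ME piM.
set D := diag_part M in ME *; set Qd' := diag_part Q; set K := H *m Qd'.
(* This is [(I - P) M = mu e^T - P D] multiplied by [Qd'], with [Qd' mu = - e] and
   [Qd' P = Qd' - Q]. *)
have QM : Q *m M = - (ones *m ones^T) + (Q - Qd') *m D.
  have Q' : Qd' *m jump_matrix Q = Qd' - Q.
    have QE : Q = Qd' - Qd' *m jump_matrix Q.
      by rewrite {1}(generator_factor Qd) mulmxBr mulmx1.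
    by rewrite [X in _ = _ - X]QE subKr.
  have PM : (1%:M - jump_matrix Q) *m M =
      (\col_i (- Q i i)^-1) *m ones^T - jump_matrix Q *m D.
    rewrite mulmxBl mul1mx [X in X - _]ME mulmxBr.
    by rewrite (addrC (jump_matrix Q *m M)) addrA addrK.
  have Dmu : Qd' *m (\col_i (- Q i i)^-1) = - ones.
    apply/colP => a; rewrite mul_diag_mx !mxE invrN mulrN divff//.
    by rewrite -oppr_eq0 gt_eqF.
  rewrite {1}(generator_factor Qd) -mulmxA PM mulmxBr mulmxA Dmu mulmxA Q'.
  by rewrite mulNmx; congr (_ + _); rewrite -mulNmx opprB.
set s := (u^T *m ones) 0 0.
have s0 : s != 0.
  by move: ue; rewrite [_ *m _]mx11_scalar -/s; apply: contraNneq => ->; rewrite raddf0.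
have Qe : Q *m ones = 0.
  apply/colP => a; rewrite !mxE -[RHS](Qs a).
  by apply: eq_bigr => b _; rewrite mxE mulr1.
(* As [Q e = 0], the vector e is an eigenvector of [Q + e u^T] with eigenvalue [s]. *)
have He : H *m ones = s^-1 *: ones.
  have : H *m (Q + ones *m u^T) *m ones = ones by rewrite HA mul1mx.
  rewrite -mulmxA mulmxDl Qe add0r -mulmxA [u^T *m _]mx11_scalar -/s.
  rewrite mul_mx_scalar -scalemxAr => /(congr1 (fun z => s^-1 *: z)).
  by rewrite scalerA mulVf// scale1r.
have [c cE] : exists c : 'rV[R]_m, M = ones *m c + D - K *m D.
  (* Add [e u^T M] to [Q M] and complete [Q D] to [(Q + e u^T) D]: the rank-one terms collect into e
     times this row, and [H] maps e to [s^-1 e]. *)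
  exists (s^-1 *: (u^T *m M - u^T *m D - ones^T)).
  have AM : (Q + ones *m u^T) *m M =
      ones *m (u^T *m M - u^T *m D - ones^T) + (Q + ones *m u^T) *m D - Qd' *m D.
    rewrite !mulmxDl QM !mulmxBr mulmxBl !mulmxA.
    move: (Q *m D) (Qd' *m D) (ones *m u^T *m M) (ones *m u^T *m D) (_ *m ones^T).
    by move=> A1 A2 A3 A4 A5; apply/matrixP => a b; rewrite !mxE; ring.
  rewrite -[LHS]mul1mx -HA -mulmxA AM (mulmxBr H) (mulmxDr H) (mulmxA H ones) He.
  by rewrite (mulmxA H _ D) HA mul1mx (mulmxA H Qd') -scalemxAl scalemxAr.
(* On the diagonal [D] and [M] agree, so [M j j] cancels. *)
have cj j : c 0 j = K j j * M j j.
  have /matrixP/(_ j j) := cE; rewrite mul_mx_diag !mxE big_ord1 !mxE mul1r eqxx.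
  by rewrite mulr1n => /eqP; rewrite addrAC -subr_eq subrr eq_sym subr_eq0 => /eqP.
have Dpi : D *m pi = lambda *: ones.
  by apply/colP => j; rewrite mul_diag_mx !mxE mulr1 mulrC piM.
(* The trace arises here: [c_j pi_j = K_jj M_jj pi_j = lambda K_jj]. *)
have cpi : c *m pi = (lambda * \tr K)%:M.
  apply/matrixP => a b; rewrite !ord1 !mxE mulr1n mulr_sumr.
  by apply: eq_bigr => j _; rewrite cj -mulrA (mulrC (M j j)) piM mulrC.
rewrite cE [LHS]mulmxBl [X in X - _]mulmxDl -(mulmxA ones) cpi -(mulmxA K) Dpi.
rewrite mul_mx_scalar -scalemxAr [in RHS]mulmxDl [in RHS]mulmxBl mul1mx.
by rewrite mul_scalar_mx [in RHS]scalerDr scalerBr scalerA -addrA addrC.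
Qed.

(** * The exponential law: tails, finiteness and mean *)

Lemma exponential_prob_ray (R : realType) (rate r : R) : 0 < rate -> 0 <= r ->
  exponential_prob rate `]r, +oo[ = (expR (- rate * r))%:E.
Proof.
move=> rate0 r0; rewrite /exponential_prob integral_itv_obnd_cbnd; last first.
  apply/measurable_EFinP; apply: measurable_funTS.
  exact: measurable_exponential_pdf.
have cont : continuous (fun z : R^o => expR (- rate * z)).
  move=> z; apply: continuous_comp; last exact: continuous_expR.
  by apply: continuousM => //; apply: (@continuousN _ R^o); exact: cst_continuous.
rewrite (@ge0_continuous_FTC2y _ _ (fun x => - expR (- rate * x)) _ 0)//.
- by rewrite EFinN oppeK add0e.
- by move=> x _; apply: exponential_pdf_ge0; exact: ltW.
- apply: (@continuous_subspaceW R^o _ _ [set` `[0, +oo[%R]).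
    by apply: subset_itvr; rewrite bnd_simp.
  exact: within_continuous_exponential_pdf.
- rewrite -oppr0; apply: cvgN.
  rewrite (_ : (fun x => expR (- rate * x)) =
               (fun z => expR (- z)) \o (fun z => rate * z)); last first.
    by apply: eq_fun => x; rewrite mulNr.
  apply: (@cvg_comp _ _ _ _ _ _ (pinfty_nbhs R)); last exact: cvgr_expR.
  exact: gt0_cvgMry.
- by apply: cvgN; apply/cvg_at_right_filter; exact: cont.
- move=> z; rewrite in_itv/= andbT => rz; apply: derive1_exponential_pdf.
  by rewrite in_itv/= andbT (le_lt_trans r0).
Qed.

Lemma exponential_prob_neg (R : realType) (rate : R) :
  exponential_prob rate `]-oo, 0[ = 0%E.
Proof.
rewrite /exponential_prob integral0_eq// => x; rewrite /= in_itv/= => x0.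
by rewrite lt0_exponential_pdf.
Qed.

Lemma exponential_prob_fin_num (R : realType) (rate : R) (A : set R) :
  0 < rate -> measurable A -> exponential_prob rate A \is a fin_num.
Proof.
move=> rate0 mA.
have pdf0 x : (0 <= (exponential_pdf rate x)%:E)%E.
  by rewrite lee_fin exponential_pdf_ge0// ltW.
rewrite ge0_fin_numE; last exact: integral_ge0.
apply: (@le_lt_trans _ _ 1%E); last exact: ltry.
rewrite -(integral_exponential_pdf rate0); apply: ge0_subset_integral => //.
by apply/measurable_EFinP; exact: measurable_exponential_pdf.
Qed.

(** The integral of the tail, that is, the mean. The integrand is [rate^-1] times the density, whose
    mass is the tail at 0. *)
Lemma integral_expR_ray (R : realType) (rate : R) : 0 < rate ->
  (\int[lebesgue_measure]_(r in `[0%R, +oo[) (expR (- rate * r))%:E =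
   (rate^-1)%:E)%E.
Proof.
move=> rate0.
transitivity (\int[lebesgue_measure]_(r in `[0%R, +oo[)
   ((rate^-1)%:E * (exponential_pdf rate r)%:E))%E.
  apply: eq_integral => r; rewrite inE/= in_itv/= andbT => r0.
  by rewrite exponential_pdfE// -EFinM mulKf// gt_eqF.
rewrite ge0_integralZl//=; last 3 first.
- apply/measurable_EFinP; apply: measurable_funTS.
  exact: measurable_exponential_pdf.
- by move=> x _; rewrite lee_fin exponential_pdf_ge0// ltW.
- by rewrite lee_fin invr_ge0 ltW.
rewrite -integral_itv_obnd_cbnd; last first.
  apply/measurable_EFinP; apply: measurable_funTS.
  exact: measurable_exponential_pdf.
by have := exponential_prob_ray rate0 (lexx 0); rewrite /exponential_prob => ->;
  rewrite mulr0 expR0 mule1.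
Qed.

(** * Path probabilities and expected sojourns before the first passage *)

(** Index 0 is exempt, since starting in [j] is not a jump into [j]. This is exactly the event that
    sojourn [n] counts towards the first passage time. *)
Definition avoids (Omega : Type) (m : nat) (Y : nat -> Omega -> 'I_m)
    (j : 'I_m) (n : nat) : set Omega :=
  [set w | forall l, (0 < l <= n)%N -> Y l w != j].

Lemma measurable_avoids (m : nat) (d : measure_display)
    (Omega : measurableType d) (Y : nat -> Omega -> 'I_m) (j : 'I_m) (n : nat) :
  (forall n x, measurable (Y n @^-1` [set x])) -> measurable (avoids Y j n).
Proof.
move=> mY; rewrite (_ : avoids Y j n =
    \bigcap_(l in [set l | (0 < l <= n)%N]) ~` (Y l @^-1` [set j])).
  by apply: bigcap_measurableType => l _; exact: measurableC.
by apply/seteqP; split => w h l ln; have /eqP := h l ln.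
Qed.

Lemma measurable_visits (m : nat) (d : measure_display)
    (Omega : measurableType d) (Y : nat -> Omega -> 'I_m) (x : nat -> 'I_m)
    (s n : nat) :
  (forall n x, measurable (Y n @^-1` [set x])) ->
  measurable [set w | forall k, (s <= k <= n)%N -> Y k w = x k].
Proof.
move=> mY; rewrite (_ : [set w | _] =
    \bigcap_(k in [set k | (s <= k <= n)%N]) (Y k @^-1` [set x k])).
  by apply: bigcap_measurableType => k _; exact: mY.
by apply/seteqP; split.
Qed.

Lemma trivIset_visit (Omega : Type) (m : nat) (Y : Omega -> 'I_m)
    (E : 'I_m -> set Omega) :
  (forall b, E b `<=` Y @^-1` [set b]) -> trivIset [set: 'I_m] E.
Proof. by move=> EY b b' _ _ [w [/EY <- /EY <-]]. Qed.

Lemma measure_ord_partition (R : realType) (m : nat) (d : measure_display)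
    (Omega : measurableType d) (mu : {measure set Omega -> \bar R})
    (Y : Omega -> 'I_m) (D : set Omega) :
  measurable D -> (forall b, measurable (Y @^-1` [set b])) ->
  (mu D = \sum_b mu (D `&` Y @^-1` [set b]))%E.
Proof.
move=> mD mY.
have DE : D = \big[setU/set0]_(b < m) (D `&` Y @^-1` [set b]).
  rewrite -bigcup_seq; apply/seteqP; split => [w Dw|w [b _ []]//].
  by exists (Y w) => //=; rewrite mem_index_enum.
have mDY b : measurable (D `&` Y @^-1` [set b]) by exact: measurableI.
rewrite {1}DE measure_semi_additive_ord//; last by rewrite -DE.
by apply: (@trivIset_visit _ _ Y) => b w [].
Qed.

(* The taboo power accounts for the first s jumps, none of which leads to j,
   the product for the prescribed path from time s on. *)
Lemma taboo_path_prob (R : realType) (m : nat) (Q : 'M[R]_m)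
    (d : measure_display) (Omega : measurableType d)
    (Pr : 'I_m -> probability Omega R)
    (Y : nat -> Omega -> 'I_m) (T : nat -> Omega -> R)
    (i j : 'I_m) (s n : nat) (x : nat -> 'I_m) (A : set R) :
  (forall i, 0 < - Q i i) -> markov_jump_process Q Pr Y T ->
  (s <= n)%N -> measurable A ->
  (Pr i (avoids Y j s `&` [set w | forall k, (s <= k <= n)%N -> Y k w = x k]
         `&` T n @^-1` A) =
   ((taboo (jump_matrix Q) j ^+ s) i (x s) *
    \prod_(s <= k < n) jump_matrix Q (x k) (x k.+1))%:E *
   exponential_prob (- Q (x n) (x n)) A)%E.
Proof.
move=> Qd [mY mT law] sn mA; elim: s sn x => [|s IH] sn x.
  have -> : avoids Y j 0 `&` [set w | forall k, (0 <= k <= n)%N -> Y k w = x k]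
      `&` T n @^-1` A = [set w | forall k, (k <= n)%N -> Y k w = x k /\
                          (if k == n then A else setT) (T k w)].
    apply/seteqP; split=> w.
      by move=> [[_ Yx] TA] k kn; split; [exact: Yx|case: eqP => [->|]].
    move=> YT; split; [split=> [l|k kn]|]; first by case: l.
      by have [] := YT k kn.
    by have [_] := YT n (leqnn n); rewrite eqxx.
  (* Only sojourn [n] is constrained; the earlier ones range over all of [R] and contribute factors
     1. *)
  rewrite (law i n x (fun k => if k == n then A else setT)); last by move=> k; case: ifP.
  have past : (\prod_(0 <= k < n) exponential_prob (- Q (x k) (x k))
      (if k == n then A else setT) = 1)%E.
    rewrite big_nat big1// => k /andP[_ kn]; rewrite (ltn_eqF kn).
    exact: integral_exponential_pdf.
  by rewrite big_nat_recr//= eqxx past mul1e expr0 mxE eq_sym.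
(* If the path is at [j] at time [s.+1], both sides vanish: the event is empty and column [j] of the
   taboo power is zero. *)
have [xj|xj] := eqVneq (x s.+1) j.
  rewrite exprSr -mulmxE mxE big1 => [|b _]; last by rewrite mxE xj eqxx mulr0.
  rewrite mul0r mul0e (_ : _ `&` _ = set0) ?measure0//.
  rewrite -subset0 => w [[/(_ s.+1)]].
  by rewrite ltnS leq0n leqnn => /(_ isT) + /(_ s.+1); rewrite leqnn sn xj
    => /eqP + /(_ isT).
(* The event is split by the state [b] at time [s]; the induction hypothesis applies to the path [x]
   with entry [s] set to [b]. *)
pose x' b k := if k == s then b else x k.
rewrite (measure_ord_partition (Pr i) (Y := Y s)) => [||b]; last exact: mY.
2: { apply: measurableI; last by rewrite -[_ @^-1` _]setTI; exact: mT.
     by apply: measurableI; [exact: measurable_avoids|exact: measurable_visits]. }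
transitivity (\sum_b ((taboo (jump_matrix Q) j ^+ s) i b *
    (jump_matrix Q b (x s.+1) *
    \prod_(s.+1 <= k < n) jump_matrix Q (x k) (x k.+1)))%:E *
   exponential_prob (- Q (x n) (x n)) A)%E.
  apply: eq_bigr => b _.
  have x'n : x' b n = x n by rewrite /x' gtn_eqF.
  have -> : jump_matrix Q b (x s.+1) *
      \prod_(s.+1 <= k < n) jump_matrix Q (x k) (x k.+1) =
      \prod_(s <= k < n) jump_matrix Q (x' b k) (x' b k.+1).
    rewrite [RHS]big_ltn// /x' eqxx gtn_eqF//; congr (_ * _).
    apply: eq_big_nat => k /andP[sk _].
    by rewrite !gtn_eqF// (leq_trans sk).
  have x's : x' b s = b by rewrite /x' eqxx.
  have := IH (ltnW sn) (x' b); rewrite x's x'n => <-; congr (Pr i _).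
  apply/seteqP; split=> w.
    move=> [[[av Yx] TA] Yb]; split=> //; split=> [l /andP[l0 ls]|k /andP[sk kn]].
      by apply: av; rewrite l0 leqW.
    rewrite /x'; case: eqVneq => [->//|ks]; apply: Yx.
    by rewrite kn andbT ltn_neqAle eq_sym ks.
  move=> [[av Yx] TA]; have Yb : Y s w = b.
    by have := Yx s; rewrite leqnn (ltnW sn) /x' eqxx; apply.
  have Yx1 k : (s < k <= n)%N -> Y k w = x k.
    move=> /andP[sk kn]; have := Yx k.
    by rewrite kn (ltnW sk) /x' gtn_eqF//; apply.
  split=> //; split=> //; split=> // l /andP[l0].
  rewrite leq_eqVlt => /predU1P[->|ls]; last by apply: av; rewrite l0.
  by rewrite Yx1// ltnSn.
(* The exponential factor is finite, so the sum over [b] can be distributed in [R]. *)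
rewrite -(fineK (exponential_prob_fin_num (Qd (x n)) mA)).
rewrite -EFinM exprSr -mulmxE mxE !mulr_suml -sumEFin; apply: eq_bigr => b _.
by rewrite -EFinM [in RHS]mxE (negPf xj) !mulrA.
Qed.

(** The path formula with [s = n], where the product over the remaining path is empty, summed over
    the state at time [n]. *)
Lemma taboo_prob (R : realType) (m : nat) (Q : 'M[R]_m)
    (d : measure_display) (Omega : measurableType d)
    (Pr : 'I_m -> probability Omega R)
    (Y : nat -> Omega -> 'I_m) (T : nat -> Omega -> R)
    (i j : 'I_m) (n : nat) (A : set R) :
  (forall i, 0 < - Q i i) -> markov_jump_process Q Pr Y T -> measurable A ->
  (Pr i (avoids Y j n `&` T n @^-1` A) =
   \sum_b ((taboo (jump_matrix Q) j ^+ n) i b)%:E *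
      exponential_prob (- Q b b) A)%E.
Proof.
move=> Qd proc mA; have [mY mT _] := proc.
rewrite (measure_ord_partition (Pr i) (Y := Y n)) => [||b]; last exact: mY.
2: { apply: measurableI; first exact: measurable_avoids.
     by rewrite -[_ @^-1` _]setTI; exact: mT. }
apply: eq_bigr => b _.
have := taboo_path_prob i j (fun=> b) Qd proc (leqnn n) mA.
rewrite big_geq// mulr1 => <-; congr (Pr i _); rewrite setIAC.
congr (_ `&` _); congr (_ `&` _); apply/seteqP; split=> w /=.
  by move=> Yb k; rewrite -eqn_leq => /eqP <-.
by move=> /(_ n); rewrite leqnn; apply.
Qed.

(** The mean of a nonnegative variable is the integral of its tail, here a mixture of exponential
    tails. The maximum with 0 gives nonnegativity everywhere, whereas the law yields it only almost
    surely. *)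
Lemma taboo_expected_sojourn (R : realType) (m : nat) (Q : 'M[R]_m)
    (d : measure_display) (Omega : measurableType d)
    (Pr : 'I_m -> probability Omega R)
    (Y : nat -> Omega -> 'I_m) (T : nat -> Omega -> R) (i j : 'I_m) (n : nat) :
  generator Q -> (forall i, 0 < - Q i i) -> markov_jump_process Q Pr Y T ->
  (\int[Pr i]_w (\1_(avoids Y j n) w * Num.max (T n w) 0)%:E =
   ((taboo (jump_matrix Q) j ^+ n *m \col_b (- Q b b)^-1) i 0)%:E)%E.
Proof.
move=> gQ Qd proc; have [mY mT _] := proc.
pose X w : R := \1_(avoids Y j n) w * Num.max (T n w) 0.
have mX : X \in mfun.
  rewrite inE /=; apply: measurable_funM.
    by apply: measurable_indic; exact: measurable_avoids.
  exact: measurable_maxr.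
have X0 w : 0 <= mfun_Sub mX w by rewrite /= mulr_ge0// le_max lexx orbT.
transitivity ('E_(Pr i)[mfun_Sub mX])%E; first by rewrite expectation_def.
rewrite ge0_expectation_ccdf//.
pose c b := (taboo (jump_matrix Q) j ^+ n) i b.
have c0 b : 0 <= c b.
  by apply: expmx_ge0; apply: taboo_ge0; exact: jump_matrix_ge0.
transitivity (\int[lebesgue_measure]_(r in `[0%R, +oo[)
   \sum_b (c b)%:E * (expR (- (- Q b b) * r))%:E)%E.
  apply: eq_integral => r; rewrite inE/= in_itv/= andbT => r0.
  rewrite /ccdf /distribution /pushforward.
  (* Since [r >= 0], neither a zero indicator nor the truncation at 0 can produce a value above
     [r]. *)
  have -> : mfun_Sub mX @^-1` `]r, +oo[ = avoids Y j n `&` T n @^-1` `]r, +oo[.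
    apply/seteqP; split=> w; rewrite /= /X !in_itv/= !andbT indicE.
      case: (boolP (w \in avoids Y j n)) => [/set_mem wa|_].
        by rewrite mul1r lt_max [r < 0]ltNge r0 orbF.
      by rewrite mul0r ltNge r0.
    by move=> [wa rT]; rewrite mem_set// mul1r lt_max rT.
  rewrite (taboo_prob _ _ _ Qd proc)//; apply: eq_bigr => b _.
  by rewrite exponential_prob_ray.
have mexp b : measurable_fun (`[0, +oo[%classic : set R) (fun r => (expR (- (- Q b b) * r))%:E).
  apply/measurable_EFinP; apply: measurable_funTS.
  apply: measurableT_comp; first exact: measurable_expR.
  exact: mulrl_measurable.
rewrite ge0_integral_sum//; last 2 first.
- by move=> b; apply: measurable_funeM; exact: mexp.
- by move=> b r _; rewrite -EFinM lee_fin mulr_ge0// expR_ge0.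
rewrite mxE -sumEFin; apply: eq_bigr => b _.
rewrite ge0_integralZl//=; last 2 first.
- exact: mexp.
- by rewrite lee_fin.
by rewrite integral_expR_ray// mxE EFinM.
Qed.

(** * The first passage time as a series, and its mean *)

Lemma avoids_before_hit (Omega : Type) (m : nat) (Y : nat -> Omega -> 'I_m)
    (j : 'I_m) (w : Omega)
    (hits : exists n, (0 < n)%N && (Y n w == j)) (k : nat) :
  avoids Y j k w <-> (k < ex_minn hits)%N.
Proof.
case: ex_minnP => N /andP[N0 /eqP YN] minN; split=> [av|kN l /andP[l0 lk]].
  by rewrite ltnNge; apply/negP => Nk; have := av N; rewrite N0 Nk YN eqxx => /(_ isT).
apply/negP => Yl; have := minN l; rewrite l0 Yl => /(_ isT).
by rewrite leqNgt (leq_ltn_trans lk kN).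
Qed.

Lemma sum_avoids (R : realType) (Omega : Type) (m : nat)
    (Y : nat -> Omega -> 'I_m) (j : 'I_m) (w : Omega) (f : nat -> R)
    (hits : exists n, (0 < n)%N && (Y n w == j)) (n : nat) :
  (ex_minn hits <= n)%N ->
  \sum_(0 <= k < n) \1_(avoids Y j k) w * f k = \sum_(0 <= k < ex_minn hits) f k.
Proof.
move=> Nn; rewrite (@big_cat_nat _ _ _ (ex_minn hits))//=.
have -> : \sum_(ex_minn hits <= k < n) \1_(avoids Y j k) w * f k = 0.
  rewrite big_nat big1// => k /andP[Nk _]; rewrite indicE memNset ?mul0r//.
  by move=> /(avoids_before_hit hits); rewrite ltnNge Nk.
rewrite addr0; apply: eq_big_nat => k /andP[_ kN].
by rewrite indicE mem_set ?mul1r//; apply/avoids_before_hit.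
Qed.

(** Pointwise limit of [F n], which is [+oo] until [j] is hit and a sum of the earlier sojourns
    afterwards; at each point [F] is eventually constant. *)
Lemma measurable_first_passage_time (R : realType) (m : nat)
    (d : measure_display) (Omega : measurableType d)
    (Y : nat -> Omega -> 'I_m) (T : nat -> Omega -> R) (j : 'I_m) :
  (forall n x, measurable (Y n @^-1` [set x])) ->
  (forall n, measurable_fun [set: Omega] (T n)) ->
  measurable_fun [set: Omega] (first_passage_time Y T j).
Proof.
move=> mY mT.
pose F n w : \bar R := if w \in avoids Y j n then +oo%E
  else (\sum_(0 <= k < n) \1_(avoids Y j k) w * T k w)%:E.
apply: (emeasurable_fun_cvg F) => [n|w _].
  apply: measurable_fun_ifT => //.
    apply: (measurable_fun_bool true); rewrite setTI.
    rewrite (_ : _ @^-1` _ = avoids Y j n); first exact: measurable_avoids.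
    by apply/seteqP; split=> w /=; [move/set_mem|move/mem_set].
  apply/measurable_EFinP; apply: measurable_sum => k.
  apply: measurable_funM => //; apply: measurable_indic.
  exact: measurable_avoids.
rewrite /first_passage_time; case: pselect => [hits|no].
  apply: cvg_near_cst; exists (ex_minn hits) => // n /= Nn.
  rewrite /F memNset; first by rewrite sum_avoids.
  by move/(avoids_before_hit hits); rewrite ltnNge Nn.
apply: cvg_near_cst; apply: nearW => n; rewrite /F mem_set// => l /andP[l0 _].
by apply/negP => Yl; apply: no; exists l; rewrite l0.
Qed.

(** The terms vanish from the first hit on, so the partial sums stabilize. The two hypotheses fail
    only on a null set, as [never_hit_null] and [taboo_neg_sojourn] are there to show. *)
Lemma first_passage_time_series (R : realType) (Omega : Type) (m : nat)
    (Y : nat -> Omega -> 'I_m) (T : nat -> Omega -> R) (j : 'I_m) (w : Omega) :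
  (exists n, ~ avoids Y j n w) -> (forall n, avoids Y j n w -> 0 <= T n w) ->
  first_passage_time Y T j w =
  (\sum_(0 <= k <oo) (\1_(avoids Y j k) w * Num.max (T k w) 0)%:E)%E.
Proof.
move=> [n0 hit] T0; rewrite /first_passage_time; case: pselect => [hits|no].
  apply/esym/lim_near_cst => //; exists (ex_minn hits) => // n /= Nn.
  rewrite sumEFin sum_avoids//; congr EFin.
  apply: eq_big_nat => k /andP[_ kN].
  by rewrite max_l// T0//; apply/(avoids_before_hit hits).
case: hit => l /andP[l0 _].
by apply/negP => Yl; apply: no; exists l; rewrite l0.
Qed.

(** The partial sum up to [n] is [x - B ^+ n *m x], and the remainder tends to 0. *)
Lemma passage_series (R : realType) (m : nat) (B : 'M[R]_m)
    (c x : 'cV[R]_m) (i : 'I_m) :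
  x = c + B *m x -> (B ^+ n *m x) i 0 @[n --> \oo] --> (0 : R) ->
  (\sum_(0 <= k <oo) ((B ^+ k *m c) i 0)%:E = (x i 0)%:E)%E.
Proof.
move=> xE Bx; apply/cvg_lim => //.
rewrite (_ : (fun n => _) = EFin \o (fun n => x i 0 - (B ^+ n *m x) i 0)).
  apply: cvg_EFin; first exact: nearW.
  by rewrite -[X in _ --> X](subr0 (x i 0)); apply: cvgB => //; exact: cvg_cst.
apply/funext => n /=; rewrite sumEFin; congr EFin.
have /colP/(_ i) := passage_partial_sum n xE.
by rewrite [RHS]mxE summxE => ->; rewrite addrK.
Qed.

Lemma taboo_neg_sojourn (R : realType) (m : nat) (Q : 'M[R]_m)
    (d : measure_display) (Omega : measurableType d)
    (Pr : 'I_m -> probability Omega R)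
    (Y : nat -> Omega -> 'I_m) (T : nat -> Omega -> R) (i j : 'I_m) (n : nat) :
  (forall i, 0 < - Q i i) -> markov_jump_process Q Pr Y T ->
  Pr i (avoids Y j n `&` T n @^-1` `]-oo, 0[) = 0%E.
Proof.
move=> Qd proc; rewrite (taboo_prob _ _ _ Qd proc)// big1// => b _.
by rewrite exponential_prob_neg mule0.
Qed.

(** Avoiding [j] forever implies avoiding it for [n] jumps, an event whose probability is entry [i]
    of the taboo power applied to e. *)
Lemma never_hit_null (R : realType) (m : nat) (Q : 'M[R]_m)
    (d : measure_display) (Omega : measurableType d)
    (Pr : 'I_m -> probability Omega R)
    (Y : nat -> Omega -> 'I_m) (T : nat -> Omega -> R) (i j : 'I_m) :
  (forall i, 0 < - Q i i) -> markov_jump_process Q Pr Y T ->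
  (taboo (jump_matrix Q) j ^+ n *m ones) i 0 @[n --> \oo] --> (0 : R) ->
  Pr i (\bigcap_n avoids Y j n) = 0%E.
Proof.
move=> Qd proc B0; have [mY _ _] := proc.
have mE : measurable (\bigcap_n avoids Y j n).
  by apply: bigcap_measurableType => n _; exact: measurable_avoids.
have le n : (Pr i (\bigcap_n avoids Y j n) <=
    ((taboo (jump_matrix Q) j ^+ n *m ones) i 0)%:E)%E.
  have -> : ((taboo (jump_matrix Q) j ^+ n *m ones) i 0)%:E =
      Pr i (avoids Y j n `&` T n @^-1` setT).
    rewrite (taboo_prob _ _ _ Qd proc)// mxE -sumEFin; apply: eq_bigr => b _.
    by rewrite /exponential_prob integral_exponential_pdf// mule1 mxE mulr1.
  rewrite preimage_setT setIT; apply: le_measure; rewrite ?inE//.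
    exact: measurable_avoids.
  by move=> w; apply.
apply/eqP; rewrite eq_le measure_ge0 andbT.
have fin : Pr i (\bigcap_n avoids Y j n) \is a fin_num by exact: fin_num_measure.
rewrite -(fineK fin) lee_fin; apply: (ler_cvg_to (cvg_cst _) B0).
by apply: nearW => n; rewrite -lee_fin fineK.
Qed.

(** Off a null set the passage time is a series of nonnegative terms, integrated termwise; the
    resulting matrix series sums to [x]. *)
Lemma mean_first_passage_timeE (R : realType) (m : nat) (Q : 'M[R]_m)
    (d : measure_display) (Omega : measurableType d)
    (Pr : 'I_m -> probability Omega R)
    (Y : nat -> Omega -> 'I_m) (T : nat -> Omega -> R) (i j : 'I_m)
    (x : 'cV[R]_m) :
  generator Q -> (forall i, 0 < - Q i i) -> markov_jump_process Q Pr Y T ->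
  x = \col_b (- Q b b)^-1 + taboo (jump_matrix Q) j *m x ->
  (forall a, 0 <= x a 0) ->
  mean_first_passage_time Pr Y T i j = (x i 0)%:E.
Proof.
move=> gQ Qd proc xE x0; have [mY mT _] := proc.
(* Needed for e, to make passage almost sure, and for [x], the remainder of the series. *)
have cvg0 (v : 'cV[R]_m) : (forall a, 0 <= v a 0) ->
    (taboo (jump_matrix Q) j ^+ n *m v) i 0 @[n --> \oo] --> (0 : R).
  move=> v0; apply: taboo_power_cvg0 x0 v0 xE => [|a].
    by apply: taboo_ge0; exact: jump_matrix_ge0.
  by rewrite mxE invr_gt0.
pose g k w := (\1_(avoids Y j k) w * Num.max (T k w) 0)%:E.
have mg k : measurable_fun [set: Omega] (g k).
  apply/measurable_EFinP; apply: measurable_funM.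
    by apply: measurable_indic; exact: measurable_avoids.
  exact: measurable_maxr.
have g0 k w : (0 <= g k w)%E by rewrite lee_fin mulr_ge0// le_max lexx orbT.
transitivity (\int[Pr i]_w \sum_(0 <= k <oo) g k w)%E.
  apply: ae_eq_integral => //; first exact: measurable_first_passage_time.
    by apply: ge0_emeasurable_sum => // k w _ _; exact: g0.
  (* The exceptional paths: a negative sojourn before the passage, or no passage at all. *)
  pose N := \bigcup_n (avoids Y j n `&` T n @^-1` `]-oo, 0[) `|`
            \bigcap_n avoids Y j n.
  have mneg n : measurable (avoids Y j n `&` T n @^-1` `]-oo, 0[).
    apply: measurableI; first exact: measurable_avoids.
    by rewrite -[_ @^-1` _]setTI; exact: mT.
  have N0 : (Pr i).-negligible N.
    apply: negligibleU; first apply: negligible_bigcup => n.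
      by apply/negligibleP; [exact: mneg|exact: taboo_neg_sojourn Qd proc].
    apply/negligibleP; first apply: bigcap_measurableType => n _.
      exact: measurable_avoids.
    by apply: never_hit_null Qd proc _; apply: cvg0 => a; rewrite mxE.
  apply: negligibleS N0 => w /= ne; apply: contrapT => Nw; apply: ne => _.
  apply: first_passage_time_series.
    apply: contrapT => no; apply: Nw; right => n _.
    by apply: contrapT => nav; apply: no; exists n.
  move=> n av; rewrite leNgt; apply/negP => Tn; apply: Nw; left.
  by exists n => //; split => //=; rewrite in_itv.
rewrite integral_nneseries//.
under eq_eseriesr do rewrite (taboo_expected_sojourn i j _ gQ Qd proc).
by apply: passage_series => //; exact: cvg0.
Qed.

Theorem mainTheorem10 (R : realType) (m : nat) (Q : 'M[R]_m)
    (Q_generator : generator Q)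
    (Q_diag : forall i, 0 < - Q i i)
    (Q_irreducible : irreducible_mx (jump_matrix Q))
    (d : measure_display) (Omega : measurableType d)
    (Pr : 'I_m -> probability Omega R)
    (Y : nat -> Omega -> 'I_m) (T : nat -> Omega -> R)
    (process : markov_jump_process Q Pr Y T)
    (pi : 'cV[R]_m) (pi_stationary : stationary_vector (jump_matrix Q) pi)
    (u : 'cV[R]_m) (ue_neq0 : u^T *m ones != 0) :
  let lambda := \sum_i pi i ord0 / (- Q i i) in
  let H := invmx (Q + ones *m u^T) in
  let Qd := diag_part Q in
  Q + ones *m u^T \in unitmx /\
  k1 Pr Y T pi =
  map_mx EFin (lambda *: ((1%:M - H *m Qd + (\tr (H *m Qd))%:M) *m ones)).

Proof.
move=> lambda H Qd.
have P0 := jump_matrix_ge0 Q_generator Q_diag.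
have P1 := jump_matrix_sum Q_generator Q_diag.
have Pd a : jump_matrix Q a a = 0 by rewrite mxE eqxx.
pose mu : 'cV[R]_m := \col_b (- Q b b)^-1.
have mu_gt0 a : 0 < mu a 0 by rewrite mxE invr_gt0.
have [X XP] : {X : 'I_m -> 'cV[R]_m & forall j,
    X j = mu + taboo (jump_matrix Q) j *m X j /\ forall a, 0 <= X j a 0}.
  apply: (@boolp.choice _ _ (fun j x => x = mu + taboo (jump_matrix Q) j *m x /\
                                        forall a, 0 <= x a 0)) => j.
  have [x xE x0] := passage_system_solvable j P0 Pd P1 Q_irreducible
    (fun a => ltW (mu_gt0 a)).
  by exists x.
(* The columns are the algebraic solutions; they are identified with mean passage times only at the
   end. *)
pose M : 'M[R]_m := \matrix_(i, j) X j i 0.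
have colM j : col j M = X j by apply/colP => i; rewrite !mxE.
have ME := passage_column_equation (fun j => etrans (colM j)
  (etrans (XP j).1 (congr1 (fun z => mu + _ *m z) (esym (colM j))))).
have lambdaE : \sum_i pi i 0 * mu i 0 = lambda.
  by apply: eq_bigr => i _; rewrite mxE.
have piM j : pi j 0 * M j j = lambda.
  by rewrite (stationary_diag pi_stationary ME).
have M_gt0 j : 0 < M j j.
  rewrite mxE (XP j).1 mxE ltr_pwDl// mulmx_ge0// => [a b|a b].
    exact: taboo_ge0.
  by rewrite ord1; exact: (XP j).2.
(* As every [M j j] is positive, [lambda = 0] would force [pi = 0], against [pi^T e = 1]. *)
have lambda_neq0 : lambda != 0.
  apply/eqP => l0; have [_ /matrixP/(_ 0 0)] := pi_stationary.
  rewrite !mxE big1 => [/eqP|j _]; first by rewrite eq_sym oner_eq0.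
  rewrite mxE; have /eqP := piM j.
  by rewrite l0 mulf_eq0 (gt_eqF (M_gt0 j)) orbF => /eqP ->; rewrite mul0r.
(* An empty state space would make [lambda] an empty sum. *)
have j0 : 'I_m.
  case: (posnP m) => [m0|m0]; last exact: Ordinal m0.
  exfalso; move: lambda_neq0; rewrite /lambda big1 ?eqxx// => j.
  by have := ltn_ord j; rewrite {2}m0.
(* The unnormalized stationary vector of [Q]: [x^T Q_d = - pi^T] gives [x^T Q = 0], and
   [x^T e = lambda]. *)
pose x : 'cV[R]_m := \col_i (pi i 0 / (- Q i i)).
have xQ : x^T *m Q = 0.
  rewrite (generator_factor Q_diag) mulmxA.
  have -> : x^T *m diag_part Q = - pi^T.
    apply/rowP => a; rewrite mul_mx_diag !mxE invrN mulrN mulNr mulfVK//.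
    by rewrite -oppr_eq0 gt_eqF.
  by rewrite mulmxBr mulmx1 !mulNmx pi_stationary.1 subrr.
have xe : x^T *m ones != 0.
  apply: contra_neq lambda_neq0 => /matrixP/(_ 0 0); rewrite !mxE => <-.
  by apply: eq_bigr => i _; rewrite !mxE mulr1.
have U : Q + ones *m u^T \in unitmx.
  exact: (generator_rank1_unitmx j0 Q_generator Q_diag Q_irreducible xQ xe).
split=> //.
rewrite -(passage_matrix_formula Q_generator Q_diag ue_neq0 (mulVmx U) ME piM).
apply/colP => i; rewrite !mxE -sumEFin; apply: eq_bigr => j _.
rewrite (mean_first_passage_timeE i Q_generator Q_diag process (XP j).1 (XP j).2).
by rewrite mxE -EFinM mulrC.
Qed.
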